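(* Let $X$ be a random variable on a finite set $\mathcal{X}$ with distribution $p_X$, let $\mathcal{H}$ be a finite-dimensional Hilbert space, and let $\mathcal{E}=\{(\rho_x,p_X(x))\}_{x\in\mathcal{X}}$ be a quantum ensemble of density matrices on $\mathcal{H}$. Let $\mathcal{N}:\mathcal{L}(\mathcal{H})\to\mathcal{L}(\mathcal{H}')$ be a quantum channel, i.e. a completely positive trace-preserving linear map, where $\mathcal{H}'$ is a finite-dimensional Hilbert space, and define $\mathcal{N}(\mathcal{E})=\{(\mathcal{N}(\rho_x),p_X(x))\}_{x\in\mathcal{X}}$. Then $$G(X|\mathcal{E})\le G(X|\mathcal{N}(\mathcal{E})).$$
   Context: $\mathcal{L}(\mathcal{H})$ is the space of linear operators on $\mathcal{H}$. Let $n=|\mathcal{X}|$. A POVM on a finite-dimensional Hilbert space is a family $E=\{E_y\}_{y\in\mathcal{Y}}$, indexed by a finite set $\mathcal{Y}$ (which may depend on $E$), of positive semidefinite operators on it with $\sum_yE_y=I$. Given an ensemble $\mathcal{E}=\{(\rho_x,p_X(x))\}_{x\in\mathcal{X}}$ of density matrices on a finite-dimensional Hilbert space and a POVM $E$ on the same space, $Y_E$ is the $\mathcal{Y}$-valued random variable with joint law $p_{X,Y_E}(x,y)=p_X(x)\operatorname{Tr}[E_y\rho_x]$. A guessing strategy $\sigma$ assigns to each $y\in\mathcal{Y}$ a bijection $\sigma_y:\{1,\dots,n\}\to\mathcal{X}$ ($\sigma_y(i)$ is the $i$-th guess when $y$ is observed), and $$\mathcal{G}_\sigma(X|Y_E)=\sum_{y\in\mathcal{Y}}\sum_{i=1}^n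 i\cdot p_{X,Y_E}(\sigma_y(i),y).$$ The quantum guesswork of $X$ given $\mathcal{E}$ is $G(X|\mathcal{E})=\inf_{\sigma,E}\mathcal{G}_\sigma(X|Y_E)$, over all POVMs $E$ on the Hilbert space carrying the states of $\mathcal{E}$ and all strategies $\sigma$. *)

(* Defs.v *)
(* Finite-dimensional Hilbert spaces are C^d with the standard
   inner product, operators on them are square matrices over C = R[i]. *)
From HB Require Import structures.
From mathcomp Require Import all_boot all_order all_algebra.
From mathcomp Require Import all_classical all_reals.
From mathcomp Require Import complex mxtens.

Set Implicit Arguments.
Unset Strict Implicit.
Unset Printing Implicit Defensive.

Import Order.TTheory GRing.Theory Num.Theory.
Local Open Scope classical_set_scope.
Local Open Scope sesquilinear_scope.
Local Open Scope complex_scope.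
Local Open Scope ring_scope.

(* In R[i], [0 <= z] means that z is real and nonnegative, so this condition
   entails that A is Hermitian. *)
Definition psd (R : realType) (d : nat) (A : 'M[R[i]]_d) : Prop :=
  forall v : 'cV[R[i]]_d, 0 <= (v ^t* *m A *m v) 0 0.

Definition density (R : realType) (d : nat) (rho : 'M[R[i]]_d) : Prop :=
  psd rho /\ \tr rho = 1.

Definition distribution (R : realType) (X : finType) (p : X -> R) : Prop :=
  (forall x, 0 <= p x) /\ \sum_(x : X) p x = 1.

Definition povm (R : realType) (d : nat) (Y : finType)
    (E : Y -> 'M[R[i]]_d) : Prop :=
  (forall y, psd (E y)) /\ \sum_(y : Y) E y = 1%:M.

Definition tens_block (R : realType) (k d : nat) (A : 'M[R[i]]_(k * d))
    (i j : 'I_k) : 'M[R[i]]_d :=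
  \matrix_(a, b) A (mxtens_index (i, a)) (mxtens_index (j, b)).

(* id_k (x) N, using A = \sum_(i, j) delta_mx i j *t tens_block A i j. *)
Definition ampliation (R : realType) (d d' k : nat)
    (N : {linear 'M[R[i]]_d -> 'M[R[i]]_d'}) (A : 'M[R[i]]_(k * d)) :
    'M[R[i]]_(k * d') :=
  \sum_(i < k) \sum_(j < k) delta_mx i j *t N (tens_block A i j).

Definition completely_positive (R : realType) (d d' : nat)
    (N : {linear 'M[R[i]]_d -> 'M[R[i]]_d'}) : Prop :=
  forall (k : nat) (A : 'M[R[i]]_(k * d)), psd A -> psd (ampliation N A).

Definition trace_preserving (R : realType) (d d' : nat)
    (N : {linear 'M[R[i]]_d -> 'M[R[i]]_d'}) : Prop :=
  forall A, \tr (N A) = \tr A.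

Definition quantum_channel (R : realType) (d d' : nat)
    (N : {linear 'M[R[i]]_d -> 'M[R[i]]_d'}) : Prop :=
  completely_positive N /\ trace_preserving N.

(* The trace is real for positive semidefinite operators; [Re] only moves it
   from R[i] to R. *)
Definition joint_law (R : realType) (X Y : finType) (d : nat)
    (p : X -> R) (rho : X -> 'M[R[i]]_d) (E : Y -> 'M[R[i]]_d)
    (x : X) (y : Y) : R :=
  p x * complex.Re (\tr (E y *m rho x)).

(* Guesses are numbered from 0 in 'I_#|X|, so the guess [sigma y i] has
   cost i.+1. *)
Definition strategy_guesswork (R : realType) (X Y : finType) (d : nat)
    (p : X -> R) (rho : X -> 'M[R[i]]_d) (E : Y -> 'M[R[i]]_d)
    (sigma : Y -> 'I_#|X| -> X) : R :=
  \sum_(y : Y) \sum_(i < #|X|) i.+1%:R * joint_law p rho E (sigma y i) y.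

(* When p is a distribution and every rho x is a density matrix, the set is
   nonempty and bounded below by 0, so [inf] is its greatest lower bound. *)
Definition guesswork (R : realType) (X : finType) (d : nat)
    (p : X -> R) (rho : X -> 'M[R[i]]_d) : R :=
  inf [set g : R | exists (Y : finType) (E : Y -> 'M[R[i]]_d)
                          (sigma : Y -> 'I_#|X| -> X),
         [/\ povm E, (forall y, bijective (sigma y)) &
             g = strategy_guesswork p rho E sigma]].

(* Main.v *)
(* Heisenberg picture: the adjoint of N for the trace pairing is positive
   because N is, and unital because N preserves the trace, so it turns a POVM E
   on the output space into a POVM on the input space with the same joint law.
   Hence every guesswork value achievable on the output ensemble is achievable
   on the input ensemble. *)
Require Import Defs.
From HB Require Import structures.
From mathcomp Require Import all_boot all_order all_algebra.
From mathcomp Require Import all_classical all_reals.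
From mathcomp Require Import complex mxtens.

Set Implicit Arguments.
Unset Strict Implicit.
Unset Printing Implicit Defensive.

Import Order.TTheory GRing.Theory Num.Theory.
Local Open Scope complex_scope.
Local Open Scope ring_scope.
Local Open Scope sesquilinear_scope.

Lemma mulmx_row_diagE (C : numClosedFieldType) (m d : nat)
    (P : 'M[C]_(m, d)) (A : 'M[C]_d) (i : 'I_m) :
  (P *m A *m P^t*) i i = (row i P *m A *m (row i P)^t*) 0 0.
Proof.
rewrite -row_mul !mxE; apply: eq_bigr => j _.
by rewrite !mxE.
Qed.

(** The rows of the unitary [P] are adjoints of eigenvectors, so each eigenvalue is a value of the
    quadratic form. Sign or vanishing of the form thus passes to the spectrum. *)
Lemma spectral_diagE (C : numClosedFieldType) (d : nat) (A : 'M[C]_d)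
    (P := spectralmx A) (i : 'I_d) : A \is normalmx ->
  spectral_diag A 0 i = (row i P *m A *m (row i P)^t*) 0 0.
Proof.
move=> /orthomx_spectralP A_eq; have Pu := spectral_unitarymx A.
rewrite -mulmx_row_diagE {2}A_eq -invmx_unitary // !mulmxA.
rewrite mulmxV ?spectral_unit // mul1mx -mulmxA mulmxV ?spectral_unit // mulmx1.
by rewrite !mxE eqxx mulr1n.
Qed.

Lemma psd_row (R : realType) (d : nat) (A : 'M[R[i]]_d) (u : 'rV[R[i]]_d) :
  psd A -> 0 <= (u *m A *m u^t*) 0 0.
Proof. by move=> /(_ (u^t*)); rewrite trmxCK. Qed.

(** The form of [A] is real, so that of the skew-Hermitian [D] vanishes. As [D] is normal, its
    eigenvalues are values of this form, hence [D = 0]. *)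
Lemma psd_trmxC (R : realType) (d : nat) (A : 'M[R[i]]_d) :
  psd A -> A^t* = A.
Proof.
move=> A_psd; pose D := A - A^t*.
have D_form (u : 'rV[R[i]]_d) : (u *m D *m u^t*) 0 0 = 0.
  have uAu : u *m A^t* *m u^t* = (u *m A *m u^t*)^t*.
    by rewrite !trmx_mul !map_mxM trmxCK mulmxA.
  rewrite mulmxBr mulmxBl uAu.
  have /CrealP uAu_real := ger0_real (psd_row u A_psd).
  set B := u *m A *m u^t* in uAu_real *.
  by rewrite mxE [X in _ + X]mxE [X in - X]mxE [X in _ - X^*]mxE uAu_real subrr.
have D_skew : D^t* = - D.
  by rewrite linearB /= map_mxB trmxCK opprB.
have D_normal : D \is normalmx.
  by apply/normalmxP; rewrite D_skew mulmxN mulNmx.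
have D_diag : spectral_diag D = 0.
  by apply/rowP => i; rewrite spectral_diagE // D_form mxE.
have /orthomx_spectralP D_eq := D_normal.
apply/esym/eqP; rewrite -subr_eq0 -/D D_eq D_diag.
by rewrite linear0 mulmx0 mul0mx.
Qed.

Lemma psd_trace_mul_ge0 (R : realType) (d : nat) (A B : 'M[R[i]]_d) :
  psd A -> psd B -> 0 <= \tr (A *m B).
Proof.
move=> A_psd B_psd.
have B_normal : B \is normalmx by apply/normalmxP; rewrite psd_trmxC.
have /orthomx_spectralP -> := B_normal.
(* Only [B] is diagonalized: the trace becomes the sum of its eigenvalues weighted by the diagonal
   of [A] in its eigenbasis. *)
rewrite invmx_unitary ?spectral_unitarymx // mulmxA mxtrace_mulC !mulmxA.
rewrite mul_mx_diag; apply: sumr_ge0 => i _.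
rewrite mxE mulmx_row_diagE spectral_diagE //.
by apply: mulr_ge0; exact: psd_row.
Qed.

Lemma psd_conj (R : realType) (m d : nat) (C : 'M[R[i]]_(m, d))
    (A : 'M[R[i]]_d) : psd A -> psd (C *m A *m C^t*).
Proof.
move=> A_psd v; have := A_psd (C^t* *m v).
by rewrite trmx_mul map_mxM trmxCK !mulmxA.
Qed.

Lemma psd1 (R : realType) (d : nat) : psd (1%:M : 'M[R[i]]_d).
Proof.
move=> v; rewrite mulmx1 mxE; apply: sumr_ge0 => i _.
by rewrite !mxE mulrC mul_conjC_ge0.
Qed.

Lemma psd_outer (R : realType) (d : nat) (v : 'cV[R[i]]_d) : psd (v *m v^t*).
Proof. by rewrite -[v in v *m _]mulmx1; apply/psd_conj/psd1. Qed.

Lemma psd_mxsub (R : realType) (m d : nat) (f : 'I_m -> 'I_d)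
    (A : 'M[R[i]]_d) : psd A -> psd (mxsub f f A).
Proof.
move=> /(psd_conj (rowsub f 1%:M)).
suff -> : rowsub f 1%:M *m A *m (rowsub f 1%:M)^t* = mxsub f f A by [].
rewrite -rowsubE trmx_mxsub trmx1 map_mxsub map_mx1.
by rewrite mulmx_colsub mulmx1 -mxsubcr.
Qed.

Lemma completely_positive_psd (R : realType) (d d' : nat)
    (N : {linear 'M[R[i]]_d -> 'M[R[i]]_d'}) (A : 'M[R[i]]_d) :
  completely_positive N -> psd A -> psd (N A).
Proof.
move=> N_cp A_psd.
(* Positivity is the case [k = 1] of complete positivity. Reindexing carries [A] to size [1 * d] and
   the image back to size [d']. *)
pose in2 (k : 'I_(1 * d)) := (mxtens_unindex k).2.
have := N_cp 1 _ (psd_mxsub in2 A_psd); rewrite /ampliation !big_ord1.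
have -> : tens_block (mxsub in2 in2 A) 0 0 = A.
  by apply/matrixP => a b; rewrite !mxE /in2 !mxtens_indexK.
move=> /(psd_mxsub (fun a => mxtens_index (0, a))).
set M := mxsub _ _ _; suff -> : M = N A by [].
by apply/matrixP => a b; rewrite !mxE !mxtens_indexK /= mul1r.
Qed.

(** The transposed [delta_mx j i] is forced by the trace pairing: the trace of [M *m delta_mx j i]
    is [M i j]. *)
Definition dual_map (F : comNzRingType) (d d' : nat)
    (N : {linear 'M[F]_d -> 'M[F]_d'}) (B : 'M[F]_d') : 'M[F]_d :=
  \matrix_(i, j) \tr (B *m N (delta_mx j i)).

Lemma mxtrace_dual_map (F : comNzRingType) (d d' : nat)
    (N : {linear 'M[F]_d -> 'M[F]_d'}) (B : 'M[F]_d') (A : 'M[F]_d) :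
  \tr (dual_map N B *m A) = \tr (B *m N A).
Proof.
transitivity (\sum_i \sum_j A i j * \tr (B *m N (delta_mx i j))).
  rewrite exchange_big; apply: eq_bigr => j _; rewrite mxE.
  by apply: eq_bigr => i _; rewrite mxE mulrC.
rewrite [A in RHS]matrix_sum_delta !linear_sum; apply: eq_bigr => i _.
rewrite !linear_sum; apply: eq_bigr => j _.
by rewrite linearZ /= -scalemxAr mxtraceZ.
Qed.

Lemma povm_dual_map (R : realType) (d d' : nat) (Y : finType)
    (N : {linear 'M[R[i]]_d -> 'M[R[i]]_d'}) (E : Y -> 'M[R[i]]_d') :
  quantum_channel N -> povm E -> povm (fun y => dual_map N (E y)).
Proof.
move=> [N_cp N_tp] [E_psd E_sum]; split=> [y v|].
  (* By cyclicity the form at [v] is the pairing of [E y] with the image under [N] of the rank-one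
     [v *m v^t*]. *)
  rewrite -trace_mx11 -mulmxA mxtrace_mulC -mulmxA mxtrace_dual_map.
  apply: psd_trace_mul_ge0 => //.
  by apply: completely_positive_psd => //; exact: psd_outer.
apply/matrixP => i j; rewrite summxE.
under eq_bigr do rewrite mxE.
rewrite -linear_sum /= -mulmx_suml E_sum mul1mx N_tp [RHS]mxE.
(* Splitting the matrix unit as column times row and cycling leaves a 1 by 1 trace, nonzero only for
   [i = j]. *)
rewrite -(mul_delta_mx (0 : 'I_1)) mxtrace_mulC mul_delta_mx_cond trace_mx11.
by case: (i == j); rewrite ?mulr0n mxE.
Qed.

Lemma strategy_guesswork_dual_map (R : realType) (X Y : finType) (d d' : nat)
    (p : X -> R) (rho : X -> 'M[R[i]]_d)
    (N : {linear 'M[R[i]]_d -> 'M[R[i]]_d'}) (E : Y -> 'M[R[i]]_d')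
    (sigma : Y -> 'I_#|X| -> X) :
  strategy_guesswork p (fun x => N (rho x)) E sigma =
  strategy_guesswork p rho (fun y => dual_map N (E y)) sigma.
Proof.
apply: eq_bigr => y _; apply: eq_bigr => i _.
by rewrite /joint_law mxtrace_dual_map.
Qed.

Lemma strategy_guesswork_ge0 (R : realType) (X Y : finType) (d : nat)
    (p : X -> R) (rho : X -> 'M[R[i]]_d) (E : Y -> 'M[R[i]]_d)
    (sigma : Y -> 'I_#|X| -> X) :
  (forall x, 0 <= p x) -> (forall x, psd (rho x)) -> (forall y, psd (E y)) ->
  0 <= strategy_guesswork p rho E sigma.
Proof.
move=> p_ge0 rho_psd E_psd; apply: sumr_ge0 => y _; apply: sumr_ge0 => i _.
apply: mulr_ge0 => //; apply: mulr_ge0 => //.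
by have := psd_trace_mul_ge0 (E_psd y) (rho_psd (sigma y i));
  rewrite lecE => /andP[].
Qed.

Theorem theorem4 (R : realType) (X : finType) (d d' : nat)
    (p : X -> R) (rho : X -> 'M[R[i]]_d)
    (N : {linear 'M[R[i]]_d -> 'M[R[i]]_d'})
    (hp : distribution p)
    (hrho : forall x, density (rho x))
    (hN : quantum_channel N) :
  guesswork p rho <= guesswork p (fun x => N (rho x)).
Proof.
apply: lb_le_inf.
  (* The one-outcome measurement, guessing in enumeration order, shows that the output set is
     nonempty; on an empty set [inf] would default to 0. *)
  exists (strategy_guesswork p (fun x => N (rho x)) (fun _ : unit => 1%:M)
            (fun _ => enum_val)).
  exists unit, (fun=> 1%:M), (fun=> enum_val); split=> //.
    by split=> [_|]; [exact: psd1 | rewrite sumr_const card_unit].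
move=> _ [Y [E [sigma [E_povm sigma_bij ->]]]].
rewrite strategy_guesswork_dual_map; apply: ge_inf.
  (* The infimum on the input side lies below each member only once the set is bounded below, here
     by 0. *)
  exists 0 => _ [Z [F [tau [[F_psd _] _ ->]]]].
  apply: strategy_guesswork_ge0 => //; first by case: hp.
  by move=> x; have [] := hrho x.
exists Y, (fun y => dual_map N (E y)), sigma; split=> //.
exact: povm_dual_map.
Qed.
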